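(* Let $f:\mathbb{R}^n\to\mathbb{R}$ be convex and differentiable, with finite curvature constant $C_f$ with respect to the $\ell_1$-ball $\diamondsuit_n:=\{x\in\mathbb{R}^n : \|x\|_1\le 1\}$. Let $x^*\in\diamondsuit_n$ be an optimal solution of $\min_{\|x\|_1\le1}f(x)$. For each $k\ge1$, the iterate $x^{(k)}$ of the algorithm ''Sparse Greedy on the $\ell_1$-Ball'' satisfies $$f(x^{(k)})-f(x^* )\le\frac{4C_f}{k+2}.$$ Furthermore, for any $\varepsilon>0$, after at most $2\left\lceil\frac{4C_f}{\varepsilon}\right\rceil+1=O\left(\frac1\varepsilon\right)$ many steps, the algorithm (with the step-size in the second half of the iterations fixed to $\frac{2}{K+2}$, where $K:=\lceil 4C_f/\varepsilon\rceil$) has an iterate $x^{(k)}$ of sparsity $O\left(\frac1\varepsilon\right)$ satisfying $g(x^{(k)})\le\varepsilon$.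
   Context: The sparsity of a vector is its number of non-zero coordinates. The $O(\cdot)$ is for $\varepsilon\to0$, with constant depending only on $C_f$ (not on $n$). Curvature constant, with $D=\diamondsuit_n$: $$C_f:=\sup_{\substack{x,s\in D,\ \alpha\in(0,1],\\ y=x+\alpha(s-x)}}\frac{1}{\alpha^2}\bigl(f(y)-f(x)-(y-x)^T\nabla f(x)\bigr).$$ Duality gap at $x\in\diamondsuit_n$: $g(x):=\max_{y\in\diamondsuit_n}(x-y)^T\nabla f(x)=\|\nabla f(x)\|_\infty+x^T\nabla f(x)$. Algorithm ''Sparse Greedy on the $\ell_1$-Ball'': set $x^{(0)}:=0$. For $k=0,1,2,\dots$: compute $i\in\arg\max_j|(\nabla f(x^{(k)}))_j|$, let $s:=\mathbf{e}_i\cdot\mathrm{sign}\bigl((-\nabla f(x^{(k)}))_i\bigr)$ where $\mathbf{e}_i$ is the $i$-th standard unit vector, let $\alpha:=\frac{2}{k+2}$, and update $x^{(k+1)}:=x^{(k)}+\alpha(s-x^{(k)})$. For the duality gap statement, the step-sizes are $\alpha=\frac{2}{k+2}$ for $0\le k\le K$ and $\alpha=\frac{2}{K+2}$ for $K\le k\le 2K+1$. *)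

(* Defs.v *)
From HB Require Import structures.
From mathcomp Require Import all_boot all_order all_algebra.
From mathcomp Require Import all_classical all_reals all_analysis.

Set Implicit Arguments.
Unset Strict Implicit.
Unset Printing Implicit Defensive.

Import Order.TTheory GRing.Theory Num.Theory.
Import numFieldNormedType.Exports.

Local Open Scope classical_set_scope.
Local Open Scope ring_scope.

Definition dot (R : realType) (n : nat) (u v : 'rV[R]_n) : R :=
  \sum_j u 0 j * v 0 j.

Definition grad (R : realType) (n : nat) (f : 'rV[R]_n -> R) (x : 'rV[R]_n)
    : 'rV[R]_n :=
  \row_j 'D_(delta_mx 0 j) f x.

Definition norm1 (R : realType) (n : nat) (x : 'rV[R]_n) : R :=
  \sum_j `|x 0 j|.

Definition l1_ball (R : realType) (n : nat) : set 'rV[R]_n :=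
  [set x | norm1 x <= 1].
Arguments l1_ball {R n}.

Definition curvature (R : realType) (n : nat) (f : 'rV[R]_n -> R) : \bar R :=
  ereal_sup [set r | exists x s : 'rV[R]_n, exists alpha : R,
    [/\ l1_ball x, l1_ball s, 0 < alpha <= 1 &
      let y := x + alpha *: (s - x) in
      r = ((alpha ^+ 2)^-1 * (f y - f x - dot (y - x) (grad f x)))%:E]].

(* The set is nonempty and bounded and, as the l1-ball is compact, its
   supremum is a maximum. *)
Definition duality_gap (R : realType) (n : nat) (f : 'rV[R]_n -> R)
    (x : 'rV[R]_n) : R :=
  sup [set dot (x - y) (grad f x) | y in l1_ball].

Definition sparsity (R : realType) (n : nat) (x : 'rV[R]_n) : nat :=
  #|[pred j | x 0 j != 0]|.

Definition minimizer_on (R : realType) (n : nat) (D : set 'rV[R]_n)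
    (f : 'rV[R]_n -> R) (x : 'rV[R]_n) : Prop :=
  D x /\ forall y, D y -> f x <= f y.

(* The step is a relation, since ties in the arg max may be broken
   arbitrarily. *)
Definition greedy_step (R : realType) (n : nat) (f : 'rV[R]_n -> R)
    (alpha : R) (x x' : 'rV[R]_n) : Prop :=
  exists2 i : 'I_n,
    forall j, `|grad f x 0 j| <= `|grad f x 0 i| &
    let s := Num.sg ((- grad f x) 0 i) *: delta_mx 0 i in
    x' = x + alpha *: (s - x).

Definition sparse_greedy (R : realType) (n : nat) (f : 'rV[R]_n -> R)
    (step : nat -> R) (x : nat -> 'rV[R]_n) : Prop :=
  x 0%N = 0 /\ forall k, greedy_step f (step k) (x k) (x k.+1).

Definition std_step (R : realType) (k : nat) : R := 2 / (k + 2)%:R.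

(* Only the step sizes for k <= 2 K + 1 are prescribed by the method; the
   constant continuation beyond is irrelevant to the iterates up to there. *)
Definition gap_step (R : realType) (K k : nat) : R :=
  if (k <= K)%N then 2 / (k + 2)%:R else 2 / (K + 2)%:R.

(* The absolute value only serves as the conversion from int to nat: a
   curvature constant is nonnegative, so the ceiling is as well. *)
Definition half_steps (R : realType) (C eps : R) : nat :=
  `|Num.ceil (4 * C / eps)|%N.

(* Main.v *)
Require Import Defs.
From HB Require Import structures.
From mathcomp Require Import all_boot all_order all_algebra.
From mathcomp Require Import all_classical all_reals all_analysis.
From mathcomp Require Import ring lra zify.

Set Implicit Arguments.
Unset Strict Implicit.
Unset Printing Implicit Defensive.

Import Order.TTheory GRing.Theory Num.Theory.
Import numFieldNormedType.Exports.

Local Open Scope classical_set_scope.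
Local Open Scope ring_scope.

(** The method is Frank-Wolfe on the l1-ball: the signed unit vector chosen by a
    greedy step attains the maximum that defines the duality gap, because
    pairing it with the gradient gives minus the sup norm of the gradient.
    Write [h_k] for the primal error and [g_k] for the duality gap at the
    [k]-th iterate.  Three facts carry everything:

    - the definition of the curvature, applied to the segment from the iterate
      to that vector, turns the first-order expansion of [f] into the decrease
      [h_(k+1) <= h_k - alpha g_k + alpha^2 C] ([greedy_progress]);
    - a differentiable convex function lies above its tangents, so that
      [h_k <= g_k] ([weak_duality]);
    - a greedy step moves at most one more coordinate away from zero, so that
      the [k]-th iterate has at most [k] nonzero coordinates.

    The rest concerns real sequences.  Replacing [g_k] by [h_k] in the decrease
    gives [h_(k+1) <= (1 - alpha) h_k + alpha^2 C], and [alpha = 2 / (k + 2)]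
    propagates the bound [4 C / (k + 2)] ([primal_rate]).  For the gap, suppose
    that [g_k > eps] throughout.  After [K + 1] steps
    [h <= 4 C / (K + 3) <= K eps / (K + 3)] since [4 C <= K eps], and each of
    the following [K + 1] steps of constant size [2 / (K + 2)] decreases [h] by
    at least [2 eps / (K + 2) - 4 C / (K + 2)^2]; the total decrease exceeds
    the initial error, contradicting [h >= 0] ([gap_rate]).  The sparsity
    bound [B] is the bound [2 K + 1] on the number of steps itself. *)

(** * The pairing and the l1-ball *)

Lemma dotDl (R : realType) (n : nat) (u v w : 'rV[R]_n) :
  dot (u + v) w = dot u w + dot v w.
Proof.
by rewrite /dot -big_split; apply: eq_bigr => j _; rewrite mxE mulrDl.
Qed.

Lemma dotZl (R : realType) (n : nat) (a : R) (u w : 'rV[R]_n) :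
  dot (a *: u) w = a * dot u w.
Proof. by rewrite /dot mulr_sumr; apply: eq_bigr => j _; rewrite mxE mulrA. Qed.

Lemma dotBl (R : realType) (n : nat) (u v w : 'rV[R]_n) :
  dot (u - v) w = dot u w - dot v w.
Proof. by rewrite dotDl -scaleN1r dotZl mulN1r. Qed.

Lemma dot0l (R : realType) (n : nat) (w : 'rV[R]_n) : dot 0 w = 0.
Proof. by rewrite /dot big1// => j _; rewrite mxE mul0r. Qed.

Lemma dot_delta (R : realType) (n : nat) (i : 'I_n) (w : 'rV[R]_n) :
  dot (delta_mx 0 i) w = w 0 i.
Proof.
rewrite /dot (bigD1 i)//= big1 => [|j ji].
  by rewrite mxE !eqxx mul1r addr0.
by rewrite mxE (negPf ji) andbF mul0r.
Qed.

(** Hoelder's inequality for the norms l1 and l-infinity, with any bound [M] on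
    the latter. *)
Lemma dot_ge (R : realType) (n : nat) (y g : 'rV[R]_n) (M : R) :
  0 <= M -> (forall j, `|g 0 j| <= M) -> l1_ball y -> - M <= dot y g.
Proof.
move=> M0 gM y1; rewrite lerNl.
have : `|dot y g| <= norm1 y * M.
  rewrite /norm1 mulr_suml; apply: le_trans (ler_norm_sum _ _ _) _.
  by apply: ler_sum => j _; rewrite normrM ler_wpM2l.
move=> yg; have : norm1 y * M <= M by rewrite ler_piMl.
by apply: le_trans; apply: le_trans yg; rewrite -normrN ler_norm.
Qed.

Lemma norm1_delta (R : realType) (n : nat) (c : R) (i : 'I_n) :
  norm1 (c *: delta_mx 0 i) = `|c|.
Proof.
rewrite /norm1 (bigD1 i)//= big1 => [|j ji].
  by rewrite !mxE !eqxx mulr1 addr0.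
by rewrite !mxE (negPf ji) andbF mulr0 normr0.
Qed.

Lemma l1_ball_segment (R : realType) (n : nat) (x s : 'rV[R]_n) (a : R) :
  0 <= a <= 1 -> l1_ball x -> l1_ball s -> l1_ball (x + a *: (s - x)).
Proof.
move=> /andP[a0 a1]; rewrite /l1_ball /= => x1 s1.
have : norm1 (x + a *: (s - x)) <= (1 - a) * norm1 x + a * norm1 s.
  rewrite /norm1 !mulr_sumr -big_split /=; apply: ler_sum => j _; rewrite !mxE.
  have -> : x 0 j + a * (s 0 j - x 0 j) = (1 - a) * x 0 j + a * s 0 j by ring.
  apply: le_trans (ler_normD _ _) _.
  by rewrite !normrM (ger0_norm a0) ger0_norm// subr_ge0.
move=> /le_trans; apply; nra.
Qed.

Lemma l1_ball0 (R : realType) (n : nat) : l1_ball (0 : 'rV[R]_n).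
Proof. by rewrite /l1_ball /= /norm1 big1// => j _; rewrite mxE normr0. Qed.

(** * First-order consequences of differentiability and convexity *)

Lemma deriv_grad (R : realType) (n : nat) (f : 'rV[R]_n -> R) (x v : 'rV[R]_n) :
  differentiable f x -> 'D_v f x = dot v (grad f x).
Proof.
move=> fx; rewrite deriveE// {1}(row_sum_delta v) linear_sum /dot.
by apply: eq_bigr => j _; rewrite linearZ /= mxE deriveE.
Qed.

(** Convexity bounds every difference quotient from [x] towards [y] with step
    in ]0, 1] by [f y - f x]; the directional derivative is their limit at
    [0^'+]. *)
Lemma convex_tangent (R : realType) (n : nat) (f : 'rV[R]_n -> R)
    (x y : 'rV[R]_n) :
  convex_function [set: convex_lmodType 'rV[R]_n] f -> differentiable f x ->
  f x + dot (y - x) (grad f x) <= f y.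
Proof.
move=> cf fx; rewrite addrC -lerBrDr -deriv_grad//.
have /cvg_ex[l fl] : derivable f x (y - x) by exact: diff_derivable.
have -> : 'D_(y - x) f x = l by apply/cvg_lim.
apply: (cvgr_to_le (cvg_dnbhs_at_right fl)); near=> h.
have h0 : 0 < h by near: h; exact: nbhs_right_gt.
have h1 : h <= 1 by near: h; exact: nbhs_right_le.
have := cf (Itv01 (ltW h0) h1) y x (in_setT _) (in_setT _).
rewrite convRE {1}/conv /= /unstable.onem => fyx.
rewrite [_ *: _]mulrC ler_pdivrMr//= lerBlDr.
have -> : h *: (y - x) + x = h *: y + (1 - h) *: x.
  by rewrite scalerBr scalerBl scale1r addrAC addrA.
apply: le_trans fyx _; rewrite le_eqVlt; apply/orP; left; apply/eqP.
(* The scaling in the convex combination of values is that of the regular module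
   [R^o]; retyping exposes it as the product of [R]. *)
by change (f x : R^o) with (f x); ring.
Unshelve. all: by end_near.
Qed.

(** * Curvature and duality gap *)

Lemma curvature_bound (R : realType) (n : nat) (f : 'rV[R]_n -> R) (C a : R)
    (x s : 'rV[R]_n) :
  curvature f = C%:E -> l1_ball x -> l1_ball s -> 0 < a <= 1 ->
  f (x + a *: (s - x)) <= f x + a * dot (s - x) (grad f x) + a ^+ 2 * C.
Proof.
move=> fC x1 s1 a01; have a0 : 0 < a by case/andP: a01.
rewrite -lerBlDl -ler_pdivrMl ?exprn_gt0// -lee_fin -fC.
apply: ereal_sup_ubound => /=; exists x, s, a; split=> //=.
by rewrite [x + _]addrC addrK dotZl opprD addrA.
Qed.

(** The degenerate segment [x = s = 0] contributes the value [0] to the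
    supremum. *)
Lemma curvature_ge0 (R : realType) (n : nat) (f : 'rV[R]_n -> R) (C : R) :
  curvature f = C%:E -> 0 <= C.
Proof.
have b0 := l1_ball0 R n.
move=> fC; have := @curvature_bound R n f C 1 0 0 fC b0 b0.
rewrite ltr01 lexx => /(_ isT).
by rewrite subrr scaler0 addr0 dot0l mulr0 addr0 expr1n mul1r lerDl.
Qed.

(** Provides the boundedness without which [sup] would be meaningless; with
    [M] the sup norm of the gradient the bound is the exact value of the gap. *)
Lemma duality_gap_ubound (R : realType) (n : nat) (f : 'rV[R]_n -> R)
    (x : 'rV[R]_n) (M : R) :
  0 <= M -> (forall j, `|grad f x 0 j| <= M) ->
  ubound [set dot (x - y) (grad f x) | y in l1_ball] (dot x (grad f x) + M).
Proof.
move=> M0 gM _ [y y1 <-]; rewrite dotBl lerD2l lerNl.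
exact: dot_ge.
Qed.

(** The tangent at [x] evaluated at [y] bounds the left-hand side by the term of
    the gap that belongs to [y]. *)
Lemma weak_duality (R : realType) (n : nat) (f : 'rV[R]_n -> R)
    (x y : 'rV[R]_n) :
  convex_function [set: convex_lmodType 'rV[R]_n] f -> differentiable f x ->
  l1_ball y -> f x - f y <= duality_gap f x.
Proof.
move=> cf fx y1.
apply: (@le_trans _ _ (dot (x - y) (grad f x))).
  have := convex_tangent y cf fx; rewrite !dotBl; lra.
(* The l1 norm of the gradient is a crude bound on its coordinates, enough for
   boundedness. *)
apply: ub_le_sup; last by exists y.
exists (dot x (grad f x) + norm1 (grad f x)); apply: duality_gap_ubound.
  exact: sumr_ge0.
by move=> j; rewrite /norm1 (bigD1 j)//= lerDl sumr_ge0.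
Qed.

(** * Greedy steps *)

Definition greedy_atom (R : realType) (n : nat) (g : 'rV[R]_n) (i : 'I_n)
    : 'rV[R]_n := Num.sg ((- g) 0 i) *: delta_mx 0 i.

(** Where the gradient vanishes the sign is [0] and the atom is the origin
    rather than a vertex, hence the norm is bounded by [1] but may be [0]. *)
Lemma greedy_atom_l1 (R : realType) (n : nat) (g : 'rV[R]_n) (i : 'I_n) :
  l1_ball (greedy_atom g i).
Proof.
by rewrite /l1_ball /= norm1_delta normr_sg lern1 leq_b1.
Qed.

(** The direction of the step pairs with the gradient to minus the sup norm of
    the gradient minus the pairing of [x] with it, which by
    [duality_gap_ubound] is at most minus the duality gap; the curvature bounds
    what remains. *)
Lemma greedy_progress (R : realType) (n : nat) (f : 'rV[R]_n -> R) (C a : R)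
    (x x' : 'rV[R]_n) :
  curvature f = C%:E -> 0 < a <= 1 -> l1_ball x -> greedy_step f a x x' ->
  l1_ball x' /\ f x' <= f x - a * duality_gap f x + a ^+ 2 * C.
Proof.
move=> fC a01 x1 [i gi ->] /=; rewrite -/(greedy_atom (grad f x) i).
have s1 := greedy_atom_l1 (grad f x) i; set s := greedy_atom _ _ in s1 *.
have a0 : 0 < a by case/andP: a01.
split; first by apply: l1_ball_segment => //; case/andP: a01 => /ltW -> ->.
apply: le_trans (curvature_bound fC x1 s1 a01) _.
rewrite lerD2r lerD2l -mulrN ler_pM2l// lerNr.
rewrite /duality_gap; apply: ge_sup.
  by exists (dot (x - 0) (grad f x)); exists 0 => //; exact: l1_ball0.
move=> r /(duality_gap_ubound (normr_ge0 _) gi) /le_trans; apply.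
rewrite dotBl opprB /s /greedy_atom dotZl dot_delta lerD2l.
have -> : (- grad f x) 0 i = - grad f x 0 i by rewrite mxE.
by rewrite -mulrN -normrEsg normrN.
Qed.

Lemma sparsity_greedy_step (R : realType) (n : nat) (f : 'rV[R]_n -> R) (a : R)
    (x x' : 'rV[R]_n) :
  greedy_step f a x x' -> (sparsity x' <= (sparsity x).+1)%N.
Proof.
move=> [i _ ->] /=; rewrite /sparsity.
apply: (@leq_trans #|[predU1 i & [pred j | x 0 j != 0]]|).
  apply/subset_leq_card/fintype.subsetP => j; rewrite !inE !mxE.
  apply: contraR; rewrite negb_or negbK => /andP[/negPf -> /eqP ->].
  by rewrite andbF mulr0 subr0 mulr0 addr0.
by rewrite cardU1 (leq_add (leq_b1 _) (leqnn _)).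
Qed.

Lemma sparsity_greedy (R : realType) (n : nat) (f : 'rV[R]_n -> R)
    (step : nat -> R) (x : nat -> 'rV[R]_n) (k : nat) :
  sparse_greedy f step x -> (sparsity (x k) <= k)%N.
Proof.
move=> [x0 xS]; elim: k => [|k IH].
  by rewrite x0 leqn0; apply/eqP/eq_card0 => j; rewrite !inE mxE eqxx.
exact: leq_trans (sparsity_greedy_step (xS k)) _.
Qed.

Lemma frac_step01 (R : realType) (k : nat) : 0 < (2 / (k + 2)%:R : R) <= 1.
Proof.
by rewrite divr_gt0 ?ltr0n ?addn2// ler_pdivrMr ?ltr0n// mul1r ler_nat.
Qed.

Lemma greedy_run (R : realType) (n : nat) (f : 'rV[R]_n -> R) (C : R)
    (step : nat -> R) (x : nat -> 'rV[R]_n) :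
  curvature f = C%:E -> (forall k, 0 < step k <= 1) ->
  sparse_greedy f step x ->
  forall k, l1_ball (x k) /\
    f (x k.+1) <= f (x k) - step k * duality_gap f (x k) + step k ^+ 2 * C.
Proof.
move=> fC step01 [x0 xS].
have xB k : l1_ball (x k).
  elim: k => [|k IH]; first by rewrite x0; exact: l1_ball0.
  by have [] := greedy_progress fC (step01 k) IH (xS k).
by move=> k; split=> //; have [] := greedy_progress fC (step01 k) (xB k) (xS k).
Qed.

(** * Rates for the real recursion *)

(** The step from [t = k + 2] to [t + 1] comes down to
    [(t - 1) / t^2 <= 1 / (t + 1)].  The start is the first step: its size is
    [1], so it cancels the unknown [h 0] and leaves [h 1 <= C].  The bound [N]
    is there because in the gap estimate only the first part of the run uses
    these step sizes. *)
Lemma primal_rate (R : realType) (C : R) (h g : nat -> R) (N : nat) :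
  0 <= C -> (forall k, h k <= g k) ->
  (forall k, (k < N)%N ->
    h k.+1 <= h k - std_step R k * g k + std_step R k ^+ 2 * C) ->
  forall k, (1 <= k <= N)%N -> h k <= 4 * C / (k + 2)%:R.
Proof.
move=> C0 hg hS; elim=> [//|[_|k IH]] kN.
  have := hS 0%N kN; have := hg 0%N.
  rewrite /std_step add0n divff ?pnatr_eq0// => ? ?.
  by rewrite ler_pdivlMr ?ltr0n//; lra.
have {}IH : h k.+1 <= 4 * C / (k.+1 + 2)%:R.
  by apply: IH; rewrite /= ltnW.
have := hS k.+1 kN; have := hg k.+1; move: IH.
have -> : (k.+2 + 2)%:R = (k.+1 + 2)%:R + 1 :> R by rewrite natr1.
rewrite /std_step.
have : 2 <= (k.+1 + 2)%:R :> R by rewrite ler_nat leq_addl.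
move: (k.+1 + 2)%:R => t t2.
have t0 : 0 < t by lra.
have tV : t * t^-1 = 1 by rewrite divff// gt_eqF.
have : 0 < t^-1 by rewrite invr_gt0.
(* With [u] the inverse of [t], the step size is [2 * u]. *)
move: tV; move: t^-1 => u tu u0 hk hgk hk1.
rewrite ler_pdivlMr; last by lra.
have u1 : 2 * u <= 1 by rewrite -[leRHS]tu ler_pM2r.
have h1 : h k.+2 <= 4 * C * (u - u ^+ 2).
  have ug : 2 * u * h k.+1 <= 2 * u * g k.+1 by rewrite ler_pM2l//; lra.
  have hu : (1 - 2 * u) * h k.+1 <= (1 - 2 * u) * (4 * C * u).
    by apply: ler_wpM2l hk; lra.
  lra.
have : 4 * C * (u - u ^+ 2) * (t + 1) <= 4 * C.
  have -> : 4 * C * (u - u ^+ 2) * (t + 1) =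
     4 * C * (u + t * u - u ^+ 2 - t * u * u) by ring.
  rewrite tu; nra.
by apply: le_trans; rewrite ler_pM2r//; lra.
Qed.

(** The contradiction needs only that the total decrease over the second half
    beats the error at its start, which after clearing denominators is
    [(K + 1) (K + 3) (2 (K + 2) eps - 4 C) > 4 C (K + 2)^2] and follows from
    [4 C <= eps K]. *)
Lemma gap_rate (R : realType) (C eps : R) (h g : nat -> R) (K : nat) :
  0 <= C -> 0 < eps -> 4 * C <= eps * K%:R ->
  (forall k, 0 <= h k) -> (forall k, h k <= g k) ->
  (forall k, (k < (K + K).+2)%N ->
    h k.+1 <= h k - gap_step R K k * g k + gap_step R K k ^+ 2 * C) ->
  exists2 k, (k <= 2 * K + 1)%N & g k <= eps.
Proof.
move=> C0 e0 CK h0 hg hS; apply: contrapT => nogap.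
have gt_eps k : (k <= 2 * K + 1)%N -> eps < g k.
  by move=> kK; rewrite ltNge; apply/negP => ge; apply: nogap; exists k.
have hK : h K.+1 <= 4 * C / (K.+1 + 2)%:R.
  apply: (@primal_rate R C h g K.+1) => //=.
  move=> k kK; have := hS k; rewrite /gap_step (kK : (k <= K)%N); apply; lia.
(* From iterate [K.+1] on the step size is constant, so that the decreases add
   up linearly. *)
have tail j : (j <= K.+1)%N ->
    h (K.+1 + j)%N <= h K.+1
      - j%:R * (2 / (K + 2)%:R * eps - (2 / (K + 2)%:R) ^+ 2 * C).
  elim: j => [|j IH] jK; first by rewrite addn0 mul0r subr0.
  have late : gap_step R K (K.+1 + j) = 2 / (K + 2)%:R.
    by rewrite /gap_step leqNgt addSn ltnS leq_addr.
  have := hS (K.+1 + j)%N ltac:(lia); rewrite late => hj.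
  have := gt_eps (K.+1 + j)%N ltac:(lia); have := IH (ltnW jK).
  have : 0 < 2 / (K + 2)%:R :> R by rewrite divr_gt0// ltr0n addn2.
  rewrite (addnS K.+1 j) -[j.+1%:R]natr1.
  move: hj; move: (2 / (K + 2)%:R) => a hj a0 IH' ge.
  have age : a * eps < a * g (K.+1 + j)%N by rewrite ltr_pM2l.
  lra.
have := tail K.+1 (leqnn _); have := h0 (K.+1 + K.+1)%N.
move: hK CK; rewrite !natrD -[K.+1%:R]natr1; have : 0 <= K%:R :> R by [].
move: K%:R => t t0 hK CK hpos hlast.
have : 0 < (t + 1) * (2 / (t + 2) * eps - (2 / (t + 2)) ^+ 2 * C)
   - 4 * C / (t + 1 + 2).
  have -> : (t + 1) * (2 / (t + 2) * eps - (2 / (t + 2)) ^+ 2 * C)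
   - 4 * C / (t + 1 + 2) =
   ((t + 1) * (2 * (t + 2) * eps - 4 * C) * (t + 3) - 4 * C * (t + 2) ^+ 2)
     / ((t + 2) ^+ 2 * (t + 3)) by field; lra.
  apply: divr_gt0; last by rewrite mulr_gt0 ?exprn_gt0//; lra.
  (* Collecting the terms in [4 * C] exhibits the slack [eps * t - 4 * C]. *)
  have -> : (t + 1) * (2 * (t + 2) * eps - 4 * C) * (t + 3)
     - 4 * C * (t + 2) ^+ 2 =
     ((t + 1) * (t + 3) + (t + 2) ^+ 2) * (eps * t - 4 * C)
       + eps * (4 * t ^+ 2 + 15 * t + 12) by ring.
  nra.
lra.
Qed.

(** * The number of steps *)

Lemma half_steps_ge (R : realType) (C eps : R) :
  0 < eps -> 4 * C <= eps * (half_steps C eps)%:R.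
Proof.
move=> e0; rewrite [leRHS]mulrC -ler_pdivrMr// /half_steps natr_absz.
by apply: le_trans (ceil_ge _) _; rewrite ler_int ler_norm.
Qed.

(** With [`|C|] in place of [C], as the asymptotic bound is claimed for every
    real [C], also one that is not a curvature. *)
Lemma half_steps_le (R : realType) (C eps : R) :
  0 < eps -> (half_steps C eps)%:R <= 4 * `|C| / eps + 1.
Proof.
move=> e0; rewrite /half_steps natr_absz intr_norm.
have /andP[] := ceil_itv (4 * C / eps); rewrite intrB.
have : `|4 * C / eps| = 4 * `|C| / eps.
  by rewrite !normrM normfV (gtr0_norm e0) ger0_norm.
have := ler_norm (4 * C / eps); have := ler_norm (- (4 * C / eps)).
rewrite normrN => ? ? <- ? ?.
rewrite ler_norml; lra.
Qed.

(** For [eps <= 1] the additive constants are absorbed by [eps^-1 >= 1]. *)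
Lemma steps_bigO (R : realType) (C : R) :
  (fun eps : R => (2 * half_steps C eps + 1)%:R : R)
    =O_ ((0 : R)^'+) (fun eps : R => eps^-1).
Proof.
apply/eqO_exP; exists (8 * `|C| + 3).
  by rewrite ltr_wpDl// mulr_ge0.
near=> eps.
have e0 : 0 < eps by near: eps; exact: nbhs_right_gt.
have e1 : eps <= 1 by near: eps; exact: nbhs_right_le.
rewrite [leLHS]ger0_norm// [`|eps^-1|]gtr0_norm ?invr_gt0//.
have := half_steps_le C e0; have : 1 <= eps^-1 by rewrite invf_ge1.
rewrite natrD natrM => i1 hl.
lra.
Unshelve. all: by end_near.
Qed.

Theorem theorem13 (R : realType) (C : R) :
  (fun eps : R => (2 * half_steps C eps + 1)%:R : R)
    =O_ ((0 : R)^'+) (fun eps : R => eps^-1) /\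
  exists2 B : R -> R, B =O_ ((0 : R)^'+) (fun eps : R => eps^-1) &
  forall (n : nat) (f : 'rV[R]_n -> R) (xstar : 'rV[R]_n),
    convex_function [set: convex_lmodType 'rV[R]_n] f ->
    (forall x, differentiable f x) ->
    curvature f = C%:E ->
    minimizer_on l1_ball f xstar ->
    (forall x : nat -> 'rV[R]_n, sparse_greedy f (@std_step R) x ->
       forall k : nat, (1 <= k)%N ->
         f (x k) - f xstar <= 4 * C / (k + 2)%:R) /\
    (forall eps : R, 0 < eps ->
       forall x : nat -> 'rV[R]_n,
         sparse_greedy f (gap_step R (half_steps C eps)) x ->
         exists k : nat,
           [/\ (k <= 2 * half_steps C eps + 1)%N,
               (sparsity (x k))%:R <= B eps &
               duality_gap f (x k) <= eps]).
Proof.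
split; first exact: steps_bigO.
exists (fun eps : R => (2 * half_steps C eps + 1)%:R); first exact: steps_bigO.
move=> n f xstar cf df fC [xs1 fmin].
have C0 := curvature_ge0 fC.
split=> [x xP k k1|eps e0 x xP].
  have step01 m : 0 < std_step R m <= 1 := frac_step01 R m.
  apply: (@primal_rate R C (fun k => f (x k) - f xstar)
    (fun k => duality_gap f (x k)) k) => //=.
  - by move=> m; exact: weak_duality.
  - move=> m _; have [_] := greedy_run fC step01 xP m; lra.
  - by rewrite k1 leqnn.
set K := half_steps C eps in xP *.
have step01 m : 0 < gap_step R K m <= 1.
  by rewrite /gap_step; case: ifP => _; exact: frac_step01.
have [k kK gk] : exists2 k, (k <= 2 * K + 1)%N & duality_gap f (x k) <= eps.
  apply: (@gap_rate R C eps (fun k => f (x k) - f xstar)) => //.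
  - exact: half_steps_ge.
  - move=> m; rewrite subr_ge0; apply: fmin.
    by have [] := greedy_run fC step01 xP m.
  - by move=> m; exact: weak_duality.
  - by move=> m _; have [_] := greedy_run fC step01 xP m; lra.
exists k; split=> //; rewrite ler_nat.
exact: leq_trans (sparsity_greedy k xP) kK.
Qed.
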